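(* Let $\mathsf{C}$ be a strict braided monoidal category and let $(H,\gamma_H,T_H)$ be a brace triple in $\mathsf{C}$, with underlying Hopf algebra $H=(H,\eta_H,\mu_H,\varepsilon_H,\delta_H,\lambda_H)$. Put $\mu_H^{\mathsf{BT}}=\mu_H\circ(H\otimes\gamma_H)\circ(\delta_H\otimes H)$. Then $H_{\mathsf{BT}}=(H,\eta_H,\mu_H^{\mathsf{BT}},\varepsilon_H,\delta_H,T_H)$ is a Hopf algebra in $\mathsf{C}$ and $\mathbb{H}_{\mathsf{BT}}=(H,H_{\mathsf{BT}})$ is an $\mathtt{s}$-Hopf brace in $\mathsf{C}$.
   Context: $\mathsf{C}$ is a strict braided monoidal category with tensor product $\otimes$, unit object $K$ and braiding $c$ (not assumed symmetric). For an object $P$ and a morphism $f$, $P\otimes f$ means $id_P\otimes f$ and $f\otimes P$ means $f\otimes id_P$. Algebras, coalgebras, bialgebras and Hopf algebras are internal to $\mathsf{C}$; the tensor product of coalgebras $D,E$ has coproduct $(D\otimes c_{D,E}\otimes E)\circ(\delta_D\otimes\delta_E)$ and counit $\varepsilon_D\otimes\varepsilon_E$, and the tensor product of algebras $A,B$ has product $(\mu_A\otimes\mu_B)\circ(A\otimes c_{B,A}\otimes B)$. A Hopf algebra $H=(H,\eta_H,\mu_H,\varepsilon_H,\delta_H,\lambda_H)$ is a bialgebra with a morphism (antipode) $\lambda_H$ such that $\mu_H\circ(H\otimes\lambda_H)\circ\delta_H=\eta_H\circ\varepsilon_H=\mu_H\circ(\lambda_H\otimes H)\circ\delta_H$. Hopf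 brace: a coalgebra $(H,\varepsilon_H,\delta_H)$ with two Hopf algebra structures $H_1=(H,\eta_H^1,\mu_H^1,\varepsilon_H,\delta_H,\lambda_H^1)$ and $H_2=(H,\eta_H^2,\mu_H^2,\varepsilon_H,\delta_H,\lambda_H^2)$ in $\mathsf{C}$ such that $\mu_H^2\circ(H\otimes\mu_H^1)=\mu_H^1\circ(\mu_H^2\otimes\Gamma_{H_1})\circ(H\otimes c_{H,H}\otimes H)\circ(\delta_H\otimes H\otimes H)$, where $\Gamma_{H_1}=\mu_H^1\circ(\lambda_H^1\otimes\mu_H^2)\circ(\delta_H\otimes H)$. It is denoted $\mathbb{H}=(H_1,H_2)$. $\mathtt{s}$-Hopf brace: a Hopf brace $\mathbb{H}=(H_1,H_2)$ such that (i) $(\Gamma_{H_1}\otimes H)\circ(H\otimes c_{H,H})\circ(\delta_H\otimes H)=(\Gamma_{H_1}\otimes H)\circ(H\otimes c_{H,H})\circ((c_{H,H}\circ\delta_H)\otimes H)$; (ii) $\lambda_H^1$ and $\lambda_H^2$ are isomorphisms in $\mathsf{C}$, and (ii.1) $\mu_H^1\circ(H\otimes\Gamma_{H_1})\circ((\delta_H\circ\lambda_H^2)\otimes H)=\mu_H^1\circ(H\otimes\Gamma_{H_1})\circ(((\lambda_H^2\otimes\lambda_H^2)\circ\delta_H)\otimes H)$, (ii.2) $\Gamma_{H_1}\circ(\lambda_H^2\otimes H)\circ\delta_H=(\lambda_H^1)^{-1}\circ\lambda_H^2$. Brace triple: $(H,\gamma_H,T_H)$ with $H=(H,\eta_H,\mu_H,\varepsilon_H,\delta_H,\lambda_H)$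 a Hopf algebra in $\mathsf{C}$ with $\lambda_H$ an isomorphism, and morphisms $\gamma_H:H\otimes H\to H$, $T_H:H\to H$ such that (i) $(\gamma_H\otimes H)\circ(H\otimes c_{H,H})\circ(\delta_H\otimes H)=(\gamma_H\otimes H)\circ(H\otimes c_{H,H})\circ((c_{H,H}\circ\delta_H)\otimes H)$; (ii) $\gamma_H$ is a coalgebra morphism; (iii) $\gamma_H\circ(H\otimes\mu_H)=\mu_H\circ(\gamma_H\otimes\gamma_H)\circ(H\otimes c_{H,H}\otimes H)\circ(\delta_H\otimes H\otimes H)$; (iv) $\gamma_H\circ(H\otimes\gamma_H)=\gamma_H\circ((\mu_H\circ(H\otimes\gamma_H)\circ(\delta_H\otimes H))\otimes H)$; (v) $\gamma_H\circ(\eta_H\otimes H)=id_H$; (vi) $T_H$ is an isomorphism with (vi.1) $\delta_H\circ T_H=c_{H,H}\circ(T_H\otimes T_H)\circ\delta_H$, (vi.2) $\varepsilon_H\circ T_H=\varepsilon_H$, (vi.3) $\mu_H\circ(H\otimes\gamma_H)\circ((\delta_H\circ T_H)\otimes H)=\mu_H\circ(H\otimes\gamma_H)\circ(((T_H\otimes T_H)\circ\delta_H)\otimes H)$, (vi.4) $\gamma_H\circ(H\otimes T_H)\circ\delta_H=\lambda_H$, (vi.5) $\gamma_H\circ(T_H\otimes H)\circ\delta_H=\lambda_H^{-1}\circ T_H$. *)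

(* Defs.v *)
From mathcomp Require Import ssreflect ssrfun.

Set Implicit Arguments.
Unset Strict Implicit.
Unset Printing Implicit Defensive.

Declare Scope smc_scope.
Delimit Scope smc_scope with smc.
Local Open Scope smc_scope.

(** * Strict braided monoidal categories *)

Record category := Category {
  obj :> Type;
  hom : obj -> obj -> Type;
  idm : forall A, hom A A;
  comp : forall A B C, hom B C -> hom A B -> hom A C;
  comp_assoc : forall A B C D (h : hom C D) (g : hom B C) (f : hom A B),
    comp h (comp g f) = comp (comp h g) f;
  comp_idl : forall A B (f : hom A B), comp (idm B) f = f;
  comp_idr : forall A B (f : hom A B), comp f (idm A) = f }.

Arguments hom {c} A B.
Arguments idm {c} A.
Arguments comp {c A B C} g f.

(** An identity morphism, seen through an equality of objects. *)
Definition eqhom (C : category) (A B : C) (e : A = B) : hom A B :=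
  match e in _ = X return hom A X with erefl => idm A end.

(** [f] and [g] are the same morphism, once their domains and codomains are
    identified along [eA] and [eB]. *)
Definition hom_eq_along (C : category) (A A' B B' : C) (eA : A = A')
    (eB : B = B') (f : hom A B) (g : hom A' B') : Prop :=
  comp (eqhom eB) f = comp g (eqhom eA).

Definition inverse_of (C : category) (A B : C) (f : hom A B) (g : hom B A) :=
  comp g f = idm A /\ comp f g = idm B.

Definition is_iso (C : category) (A B : C) (f : hom A B) : Prop :=
  exists g : hom B A, inverse_of f g.

(** Strictness: the tensor product is associative and unital on the nose, on
    objects and on morphisms.  Pentagon and triangle would only compare
    morphisms [eqhom _] with the same domain and codomain, which agree by
    uniqueness of identity proofs. *)
Record strict_monoidal_category := StrictMonoidalCategory {
  smc_cat :> category;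
  tens : smc_cat -> smc_cat -> smc_cat;
  unit_obj : smc_cat;
  tensm : forall A A' B B' : smc_cat,
    hom A A' -> hom B B' -> hom (tens A B) (tens A' B');
  tensm_id : forall A B : smc_cat, tensm (idm A) (idm B) = idm (tens A B);
  tensm_comp : forall (A A' A'' B B' B'' : smc_cat)
      (f' : hom A' A'') (f : hom A A') (g' : hom B' B'') (g : hom B B'),
    tensm (comp f' f) (comp g' g) = comp (tensm f' g') (tensm f g);
  tens_assoc : forall A B C : smc_cat,
    tens (tens A B) C = tens A (tens B C);
  tens_unitl : forall A : smc_cat, tens unit_obj A = A;
  tens_unitr : forall A : smc_cat, tens A unit_obj = A;
  tensm_assoc : forall (A A' B B' C C' : smc_cat)
      (f : hom A A') (g : hom B B') (h : hom C C'),
    hom_eq_along (tens_assoc A B C) (tens_assoc A' B' C')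
      (tensm (tensm f g) h) (tensm f (tensm g h));
  tensm_unitl : forall (A A' : smc_cat) (f : hom A A'),
    hom_eq_along (tens_unitl A) (tens_unitl A') (tensm (idm unit_obj) f) f;
  tensm_unitr : forall (A A' : smc_cat) (f : hom A A'),
    hom_eq_along (tens_unitr A) (tens_unitr A') (tensm f (idm unit_obj)) f }.

Arguments tens {s} A B.
Arguments unit_obj {s}.
Arguments tensm {s A A' B B'} f g.

Notation "A ⊗ B" := (tens A B) (at level 40, left associativity) : smc_scope.
Notation "f ⊗₁ g" := (tensm f g) (at level 40, left associativity) : smc_scope.

(** Equality of objects by strictness, found automatically by rebracketing and
    removing units.  It lets formulas be written as in a strict category: [g ∘ f]
    and [f ≡ g] below compose and compare morphisms whose (co)domains agree only
    up to bracketing and units.  The proof found is immaterial, by uniqueness of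
    identity proofs. *)
Class strict_eq (C : category) (A B : C) : Prop := strict_eqP : A = B.

#[export] Hint Mode strict_eq + + + : typeclass_instances.
#[export] Hint Extern 0 (strict_eq _ _) =>
  (rewrite /strict_eq ?tens_assoc ?tens_unitl ?tens_unitr; reflexivity)
  : typeclass_instances.

Definition scomp (C : category) (A B B' D : C) (e : strict_eq B B')
  (g : hom B' D) (f : hom A B) : hom A D := comp g (comp (eqhom e) f).

Arguments scomp {C A B B' D e} g f.

Definition shom_eq (C : category) (A A' B B' : C)
    (eA : strict_eq A A') (eB : strict_eq B B')
    (f : hom A B) (g : hom A' B') : Prop :=
  hom_eq_along eA eB f g.

Definition strict_id (C : category) (A B : C) (e : strict_eq A B) : hom A B :=
  eqhom e.

Arguments strict_id {C} A B {e}.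
Arguments shom_eq {C A A' B B' eA eB} f g.

Notation "g ∘ f" := (scomp g f) (at level 50, left associativity) : smc_scope.
Notation "f ≡ g" := (shom_eq f g) (at level 70, no associativity) : smc_scope.

Record strict_braided_category := StrictBraidedCategory {
  sbc_smc :> strict_monoidal_category;
  braid : forall A B : sbc_smc, hom (A ⊗ B) (B ⊗ A);
  braid_iso : forall A B : sbc_smc, is_iso (braid A B);
  braid_nat : forall (A A' B B' : sbc_smc) (f : hom A A') (g : hom B B'),
    comp (braid A' B') (f ⊗₁ g) = comp (g ⊗₁ f) (braid A B);
  braid_hexagon_r : forall A B D : sbc_smc,
    braid A (B ⊗ D) ≡ (idm B ⊗₁ braid A D) ∘ (braid A B ⊗₁ idm D);
  braid_hexagon_l : forall A B D : sbc_smc,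
    braid (A ⊗ B) D ≡ (braid A D ⊗₁ idm B) ∘ (idm A ⊗₁ braid B D) }.

Arguments braid {s} A B.

(** * Algebras, coalgebras, Hopf algebras

    Structures are separated into their data and a predicate for their axioms. *)

Record coalgebra_data (C : strict_braided_category) := CoalgebraData {
  carrier :> C;
  counit : hom carrier unit_obj;
  coprod : hom carrier (carrier ⊗ carrier) }.

Arguments counit {C} c.
Arguments coprod {C} c.

Record is_coalgebra (C : strict_braided_category) (D : coalgebra_data C) :
    Prop := IsCoalgebra {
  coalg_counitl : (counit D ⊗₁ idm D) ∘ coprod D ≡ idm D;
  coalg_counitr : (idm D ⊗₁ counit D) ∘ coprod D ≡ idm D;
  coalg_coassoc :
    (coprod D ⊗₁ idm D) ∘ coprod D ≡ (idm D ⊗₁ coprod D) ∘ coprod D }.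

Definition unit_coalgebra (C : strict_braided_category) : coalgebra_data C :=
  @CoalgebraData C unit_obj (idm unit_obj)
    (strict_id unit_obj (unit_obj ⊗ unit_obj)).

Definition tens_coalgebra (C : strict_braided_category)
    (D E : coalgebra_data C) : coalgebra_data C :=
  @CoalgebraData C (D ⊗ E)
    (strict_id (unit_obj ⊗ unit_obj) unit_obj ∘ (counit D ⊗₁ counit E))
    (strict_id (D ⊗ (E ⊗ D) ⊗ E) ((D ⊗ E) ⊗ (D ⊗ E))
       ∘ (idm D ⊗₁ braid D E ⊗₁ idm E) ∘ (coprod D ⊗₁ coprod E)).

Record is_coalgebra_morphism (C : strict_braided_category)
    (D E : coalgebra_data C) (f : hom D E) : Prop := IsCoalgebraMorphism {
  coalg_mor_counit : counit E ∘ f = counit D;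
  coalg_mor_coprod : coprod E ∘ f = (f ⊗₁ f) ∘ coprod D }.

Record is_algebra (C : strict_braided_category) (A : C)
    (eta : hom unit_obj A) (mu : hom (A ⊗ A) A) : Prop := IsAlgebra {
  alg_unitl : mu ∘ (eta ⊗₁ idm A) ≡ idm A;
  alg_unitr : mu ∘ (idm A ⊗₁ eta) ≡ idm A;
  alg_assoc : mu ∘ (mu ⊗₁ idm A) ≡ mu ∘ (idm A ⊗₁ mu) }.

(** The part of a Hopf algebra structure that lies over a given coalgebra. *)
Record hopf_data (C : strict_braided_category) (D : coalgebra_data C) :=
  HopfData {
    hunit : hom unit_obj D;
    hprod : hom (D ⊗ D) D;
    antipode : hom D D }.

Arguments HopfData {C D} hunit hprod antipode.

Section Hopf.

Variables (C : strict_braided_category) (D : coalgebra_data C).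

Local Notation H := (carrier D).
Local Notation id_H := (idm (carrier D)).
Local Notation delta := (coprod D).
Local Notation eps := (counit D).
Local Notation c := (braid (carrier D) (carrier D)).

Record is_bialgebra (eta : hom unit_obj H) (mu : hom (H ⊗ H) H) : Prop :=
  IsBialgebra {
    bialg_alg : is_algebra eta mu;
    bialg_coalg : is_coalgebra D;
    bialg_unit : @is_coalgebra_morphism C (unit_coalgebra C) D eta;
    bialg_prod : @is_coalgebra_morphism C (tens_coalgebra D D) D mu }.

Record is_hopf (X : hopf_data D) : Prop := IsHopf {
  hopf_bialg : is_bialgebra (hunit X) (hprod X);
  hopf_antipoder :
    hprod X ∘ (id_H ⊗₁ antipode X) ∘ delta = hunit X ∘ eps;
  hopf_antipodel :
    hprod X ∘ (antipode X ⊗₁ id_H) ∘ delta = hunit X ∘ eps }.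

(** * Hopf braces and brace triples *)

Definition Gamma (X1 X2 : hopf_data D) : hom (H ⊗ H) H :=
  hprod X1 ∘ (antipode X1 ⊗₁ hprod X2) ∘ (delta ⊗₁ id_H).

Record is_hopf_brace (X1 X2 : hopf_data D) : Prop := IsHopfBrace {
  brace_hopf1 : is_hopf X1;
  brace_hopf2 : is_hopf X2;
  brace_compat :
    hprod X2 ∘ (id_H ⊗₁ hprod X1)
    ≡ hprod X1 ∘ (hprod X2 ⊗₁ Gamma X1 X2) ∘ (id_H ⊗₁ c ⊗₁ id_H)
        ∘ (delta ⊗₁ id_H ⊗₁ id_H) }.

Record is_s_hopf_brace (X1 X2 : hopf_data D) : Prop := IsSHopfBrace {
  sbrace_brace : is_hopf_brace X1 X2;
  sbrace_cocomm :
    (Gamma X1 X2 ⊗₁ id_H) ∘ (id_H ⊗₁ c) ∘ (delta ⊗₁ id_H)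
    = (Gamma X1 X2 ⊗₁ id_H) ∘ (id_H ⊗₁ c) ∘ ((c ∘ delta) ⊗₁ id_H);
  sbrace_iso1 : is_iso (antipode X1);
  sbrace_iso2 : is_iso (antipode X2);
  sbrace_antipode2_coprod :
    hprod X1 ∘ (id_H ⊗₁ Gamma X1 X2) ∘ ((delta ∘ antipode X2) ⊗₁ id_H)
    = hprod X1 ∘ (id_H ⊗₁ Gamma X1 X2)
        ∘ (((antipode X2 ⊗₁ antipode X2) ∘ delta) ⊗₁ id_H);
  sbrace_antipode2_Gamma : exists2 lambda1_inv : hom H H,
    inverse_of (antipode X1) lambda1_inv &
    Gamma X1 X2 ∘ (antipode X2 ⊗₁ id_H) ∘ delta = lambda1_inv ∘ antipode X2 }.

Record is_brace_triple (X : hopf_data D) (gamma : hom (H ⊗ H) H)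
    (T : hom H H) : Prop := IsBraceTriple {
  bt_hopf : is_hopf X;
  bt_antipode_iso : is_iso (antipode X);
  bt_cocomm :
    (gamma ⊗₁ id_H) ∘ (id_H ⊗₁ c) ∘ (delta ⊗₁ id_H)
    = (gamma ⊗₁ id_H) ∘ (id_H ⊗₁ c) ∘ ((c ∘ delta) ⊗₁ id_H);
  bt_coalg_mor : @is_coalgebra_morphism C (tens_coalgebra D D) D gamma;
  bt_action_prod :
    gamma ∘ (id_H ⊗₁ hprod X)
    ≡ hprod X ∘ (gamma ⊗₁ gamma) ∘ (id_H ⊗₁ c ⊗₁ id_H)
        ∘ (delta ⊗₁ id_H ⊗₁ id_H);
  bt_action_comp :
    gamma ∘ (id_H ⊗₁ gamma)
    ≡ gamma ∘ ((hprod X ∘ (id_H ⊗₁ gamma) ∘ (delta ⊗₁ id_H)) ⊗₁ id_H);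
  bt_action_unit : gamma ∘ (hunit X ⊗₁ id_H) ≡ id_H;
  bt_T_iso : is_iso T;
  bt_T_coprod : delta ∘ T = c ∘ (T ⊗₁ T) ∘ delta;
  bt_T_counit : eps ∘ T = eps;
  bt_T_action :
    hprod X ∘ (id_H ⊗₁ gamma) ∘ ((delta ∘ T) ⊗₁ id_H)
    = hprod X ∘ (id_H ⊗₁ gamma) ∘ (((T ⊗₁ T) ∘ delta) ⊗₁ id_H);
  bt_T_antipode : gamma ∘ (id_H ⊗₁ T) ∘ delta = antipode X;
  bt_T_antipode_inv : exists2 lambda_inv : hom H H,
    inverse_of (antipode X) lambda_inv &
    gamma ∘ (T ⊗₁ id_H) ∘ delta = lambda_inv ∘ T }.

Definition mu_BT (X : hopf_data D) (gamma : hom (H ⊗ H) H) : hom (H ⊗ H) H :=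
  hprod X ∘ (id_H ⊗₁ gamma) ∘ (delta ⊗₁ id_H).

Definition H_BT (X : hopf_data D) (gamma : hom (H ⊗ H) H) (T : hom H H) :
    hopf_data D :=
  HopfData (hunit X) (mu_BT X gamma) T.

End Hopf.

(* Main.v *)
(* In Sweedler notation, with the braidings left implicit, write a ▷ x for gamma.
   The product of H_BT is a ∘ x = a1 (a2 ▷ x).  Cocommutativity relative to the
   action makes it a coalgebra morphism, and then
   (a ∘ x) ∘ y = a1 (a2 ▷ x1) ((a3 ∘ x2) ▷ y) = a ∘ (x ∘ y) because ▷ is an
   action by algebra morphisms.  On one side T is an antipode since
   a1 (a2 ▷ T(a3)) = a1 λ(a2); on the other side one gets T(a1) λ⁻¹(T(a2)), which
   λ, being antimultiplicative, maps to ηε.  Finally λ(a1) (a2 ∘ x) = a ▷ x, so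
   that Gamma is gamma, and the remaining axioms of an s-Hopf brace are axioms of
   the brace triple. *)
From mathcomp Require Import ssreflect ssrfun ssrnat.
From Stdlib Require Import Eqdep.
Require Import Defs.

Set Implicit Arguments.
Unset Strict Implicit.
Unset Printing Implicit Defensive.
Local Open Scope smc_scope.

(* Equality of morphisms across propositionally equal objects: [f ≡ g] without
   the two object equalities. *)
Inductive heq (C : category) (A B : C) (f : hom A B) :
  forall A' B' : C, hom A' B' -> Prop := heq_refl : heq f f.

(** Eliminating the object equalities leaves a plain equation. Conversely, uniqueness of identity
    proofs makes the given [eA] and [eB] reflexive, so it does not matter which proofs of strictness
    a formula carries. *)
Lemma hom_eq_heq (C : category) (A A' B B' : C) (eA : A = A') (eB : B = B')
    (f : hom A B) (g : hom A' B') : hom_eq_along eA eB f g <-> heq f g.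
Proof.
split=> [|fg].
  move: f g; case: A' / eA; case: B' / eB => f g.
  by rewrite /hom_eq_along /= comp_idl comp_idr => ->.
move: eA eB; case: A' B' g / fg => eA eB.
by rewrite (UIP_refl _ _ eA) (UIP_refl _ _ eB) /hom_eq_along /= comp_idl
  comp_idr.
Qed.

Lemma hom_eq_along_heq (C : category) (A A' B B' : C) (eA : A = A')
    (eB : B = B') (f : hom A B) (g : hom A' B') :
  hom_eq_along eA eB f g -> heq f g.
Proof. by move/hom_eq_heq. Qed.

Lemma heq_eq (C : category) (A B : C) (f g : hom A B) : heq f g -> f = g.
Proof.
by move/(hom_eq_heq (erefl A) (erefl B)); rewrite /hom_eq_along /= comp_idl
  comp_idr.
Qed.

Lemma heq_sym (C : category) (A A' B B' : C) (f : hom A B) (g : hom A' B') :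
  heq f g -> heq g f.
Proof. by case. Qed.

Lemma heq_trans (C : category) (A A' A'' B B' B'' : C) (f : hom A B)
    (g : hom A' B') (h : hom A'' B'') : heq f g -> heq g h -> heq f h.
Proof. by case. Qed.

Lemma heq_comp (C : category) (A A' B B' D D' : C) (f : hom A B)
    (f' : hom A' B') (g : hom B D) (g' : hom B' D') :
  heq g g' -> heq f f' -> heq (comp g f) (comp g' f').
Proof.
move=> gg' ff'; case: A' B' f' / ff' g' gg' => g' gg'.
have eD : D = D' by case: gg'.
by case: D' / eD g' gg' => g' /heq_eq ->.
Qed.

Lemma heq_scomp (C : category) (A A' B B' B'' D D' : C) (e : strict_eq B B'')
    (f : hom A B) (f' : hom A' B') (g : hom B'' D) (g' : hom B' D') :
  heq g g' -> heq f f' -> heq (g ∘ f) (comp g' f').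
Proof.
rewrite /scomp /strict_eq in e *.
by case: B'' / e g => g gg' ff' /=; rewrite comp_idl; apply: heq_comp.
Qed.

Lemma heq_idm (C : category) (A B : C) : A = B -> heq (idm A) (idm B).
Proof. by move->. Qed.

Lemma heq_comp_eqhom (C : category) (A B D : C) (f : hom A B) (e : D = A) :
  heq f (comp f (eqhom e)).
Proof. by case: A / e f => f /=; rewrite comp_idr. Qed.

Lemma heq_eqhom_comp (C : category) (A B D : C) (f : hom A B) (e : B = D) :
  heq f (comp (eqhom e) f).
Proof. by case: D / e; rewrite /= comp_idl. Qed.

Lemma heq_tens (C : strict_monoidal_category) (A A' B B' P P' Q Q' : C)
    (f : hom A B) (f' : hom A' B') (g : hom P Q) (g' : hom P' Q') :
  heq f f' -> heq g g' -> heq (f ⊗₁ g) (f' ⊗₁ g').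
Proof. by case=> [] []. Qed.

(* [f ⊗ id_X], with the bracketing of its domain and codomain left open. *)
Definition acts (C : strict_monoidal_category) (A B X : C) (f : hom A B)
    (P Q : C) (phi : hom P Q) := heq (f ⊗₁ idm X) phi.
Arguments acts {C A B} X f {P Q} phi.

(** * Rebracketing composites and tensor products *)

Section Acts.
Variable C : strict_monoidal_category.
Implicit Types A B X P Q R : C.

Lemma acts_scomp A B B' D X P Q R (e : strict_eq B B') (f : hom A B)
    (g : hom B' D) (phi : hom P Q) (psi : hom Q R) :
  acts X g psi -> acts X f phi -> acts X (g ∘ f) (comp psi phi).
Proof.
rewrite /scomp /strict_eq /acts in e *.
case: B' / e g => g gg' ff' /=.
rewrite comp_idl -[X in _ ⊗₁ X](comp_idl (idm X)).
by rewrite tensm_comp; apply: heq_comp.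
Qed.

Lemma acts_comp A B D X P Q R (f : hom A B)
    (g : hom B D) (phi : hom P Q) (psi : hom Q R) :
  acts X g psi -> acts X f phi -> acts X (comp g f) (comp psi phi).
Proof.
move=> gg' ff'; rewrite /acts -[X in _ ⊗₁ X](comp_idl (idm X)).
by rewrite tensm_comp; apply: heq_comp.
Qed.

Lemma tens_heqA A A' B B' D D' (f : hom A A') (g : hom B B') (h : hom D D') :
  heq ((f ⊗₁ g) ⊗₁ h) (f ⊗₁ (g ⊗₁ h)).
Proof. exact: (hom_eq_along_heq (tensm_assoc f g h)). Qed.

Lemma acts_idr A A' B X Y P Q (f : hom A A') (phi : hom P Q) :
  B ⊗ X = Y -> acts Y f phi -> acts X (f ⊗₁ idm B) phi.
Proof.
move=> <- fphi; apply: heq_trans (tens_heqA _ _ _) _.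
by rewrite tensm_id.
Qed.

Lemma acts_tens A A' B B' X Y P Q R (f : hom A A') (g : hom B B')
    (phi : hom Q R) (psi : hom P Q) :
  B' ⊗ X = Y -> acts Y f phi -> acts X (idm A ⊗₁ g) psi ->
  acts X (f ⊗₁ g) (comp phi psi).
Proof.
move=> eY fphi gpsi.
have -> : f ⊗₁ g = comp (f ⊗₁ idm B') (idm A ⊗₁ g).
  by rewrite -tensm_comp comp_idl comp_idr.
by apply: acts_comp gpsi; apply: acts_idr eY fphi.
Qed.

Lemma acts_whisk A B B' X P Q (f : hom B B') (phi : hom P Q) :
  acts X f phi -> acts X (idm A ⊗₁ f) (idm A ⊗₁ phi).
Proof.
move=> fphi; apply: heq_trans (tens_heqA _ _ _) _.
exact: heq_tens (heq_refl _) fphi.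
Qed.

Lemma acts_whisk_tens A A' B B' X P Q (f : hom B B') (phi : hom P Q) :
  acts X (idm A ⊗₁ (idm A' ⊗₁ f)) phi -> acts X (idm (A ⊗ A') ⊗₁ f) phi.
Proof.
rewrite -tensm_id; apply: heq_trans.
exact: heq_tens (tens_heqA _ _ _) (heq_refl _).
Qed.

Lemma acts_whisk_unit B B' X P Q (f : hom B B') (phi : hom P Q) :
  acts X f phi -> acts X (idm unit_obj ⊗₁ f) phi.
Proof.
apply: heq_trans; apply: heq_tens (heq_refl _).
exact: (hom_eq_along_heq (tensm_unitl f)).
Qed.

Lemma acts_id A X P : A ⊗ X = P -> acts X (idm A) (idm P).
Proof. by rewrite /acts tensm_id; apply: heq_idm. Qed.

Lemma acts_strict_id A B X P (e : strict_eq A B) :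
  A ⊗ X = P -> acts X (strict_id A B) (idm P).
Proof.
rewrite /acts /strict_id /strict_eq in e *; case: B / e => /=.
by rewrite tensm_id; apply: heq_idm.
Qed.

Lemma acts_unit A B P Q (f : hom A B) (phi : hom P Q) :
  acts unit_obj f phi <-> heq f phi.
Proof.
have ff : heq (f ⊗₁ idm unit_obj) f.
  exact: hom_eq_along_heq (tensm_unitr f).
by split; apply: heq_trans => //; apply: heq_sym.
Qed.

Lemma acts_eq A B A' B' X P Q (f : hom A B) (g : hom A' B')
    (phi psi : hom P Q) :
  acts X f phi -> acts X g psi -> heq f g -> phi = psi.
Proof.
move=> fphi gpsi fg; apply: heq_eq.
apply: heq_trans (heq_sym fphi) _; apply: heq_trans gpsi.
exact: heq_tens fg (heq_refl _).
Qed.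

Lemma acts_heq A B A' B' P Q (f : hom A B) (g : hom A' B') (phi psi : hom P Q) :
  acts unit_obj f phi -> acts unit_obj g psi -> phi = psi -> heq f g.
Proof.
move=> /acts_unit fphi /acts_unit gpsi e.
by apply: heq_trans fphi _; rewrite e; apply: heq_sym.
Qed.

End Acts.

(** * String diagrams on powers of one object *)

Section Strands.
Variables (C : strict_braided_category) (H : C).
Implicit Types X Y Z : C.

(* Right-nested powers make everything definitional: [strands j.+1 X] and
   [strands j (H ⊗ X)] are convertible, so a morphism drawn at height [k] and one
   at height [k.+1] compose without a cast, even for a variable [k]. *)
Fixpoint strands k X : C := if k is k'.+1 then strands k' (H ⊗ X) else X.

(** Identities are added on the left only; strands to the right of a generator are absorbed in the
    open end [X]. *)
Fixpoint under k X Y (f : hom X Y) : hom (strands k X) (strands k Y) :=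
  match k with
  | 0 => f
  | k'.+1 => @under k' (H ⊗ X) (H ⊗ Y) (idm H ⊗₁ f)
  end.
Arguments under k {X Y} f.

(** The separate case [1] makes [power 1] and [power 2] convertible to [H] and [H ⊗ H], so that
    structure morphisms are generators without a cast. *)
Fixpoint power k : C :=
  match k with 0 => unit_obj | 1 => H | k'.+1 => H ⊗ power k' end.

Lemma power_strands k X : power k ⊗ X = strands k X.
Proof.
case: k => [|k]; first exact: tens_unitl.
elim: k X => // k IH X.
rewrite -[strands k.+2 X]/(strands k.+1 (H ⊗ X)) -IH /=.
(* [power] grows at its left end and [strands] at its right end, so the new factor has to cross the
   power. *)
have tensHA j : H ⊗ power j.+1 = power j.+1 ⊗ H.
  by elim: j => //= j {1}->; rewrite tens_assoc.
by rewrite -/(power k.+1) tensHA tens_assoc.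
Qed.

(* Opaque, so that rewriting never unfolds a generator. *)
Lemma gen_sig a b (f : hom (power a) (power b)) X :
  {g : hom (strands a X) (strands b X) | acts X f g}.
Proof.
exists (comp (eqhom (power_strands b X))
  (comp (f ⊗₁ idm X) (eqhom (esym (power_strands a X))))).
exact: heq_trans (heq_comp_eqhom _ _) (heq_eqhom_comp _ _).
Qed.

Definition gen a b (f : hom (power a) (power b)) X :
  hom (strands a X) (strands b X) := sval (gen_sig f X).
Arguments gen a b f X : clear implicits.

Lemma acts_gen a b (f : hom (power a) (power b)) X : acts X f (gen a b f X).
Proof. exact: svalP. Qed.

Lemma under_id k X : under k (idm X) = idm (strands k X).
Proof. by elim: k X => //= k IH X; rewrite tensm_id IH. Qed.

Lemma under_comp k X Y Z (g : hom Y Z) (f : hom X Y) :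
  under k (comp g f) = comp (under k g) (under k f).
Proof.
elim: k X Y Z g f => //= k IH X Y Z g f.
by rewrite -IH -tensm_comp comp_idl.
Qed.

Lemma tens_under a X Y (f : hom X Y) : heq (idm (power a) ⊗₁ f) (under a f).
Proof.
case: a => [|a]; first exact: (hom_eq_along_heq (tensm_unitl f)).
elim: a X Y f => [|a IH] X Y f; first exact: heq_refl.
apply: heq_trans (IH _ _ (idm H ⊗₁ f)).
apply: heq_trans (tens_heqA _ _ _); apply: heq_tens => //.
rewrite !tensm_id; apply: heq_idm.
elim: a {IH} => //= a {1}->; by rewrite tens_assoc.
Qed.

(** Both composites are [f ⊗₁ phi], split in the two possible orders. *)
Lemma gen_nat a b (f : hom (power a) (power b)) X Y (phi : hom X Y) :
  comp (under b phi) (gen a b f X) = comp (gen a b f Y) (under a phi).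
Proof.
apply: heq_eq.
apply: (@heq_trans _ _ _ _ _ _ _ _ (f ⊗₁ phi)).
  have -> : f ⊗₁ phi = comp (idm (power b) ⊗₁ phi) (f ⊗₁ idm X).
    by rewrite -tensm_comp comp_idl comp_idr.
  by apply: heq_comp; apply: heq_sym; [apply: tens_under|apply: acts_gen].
have -> : f ⊗₁ phi = comp (f ⊗₁ idm Y) (idm (power a) ⊗₁ phi).
  by rewrite -tensm_comp comp_idl comp_idr.
by apply: heq_comp; [apply: acts_gen|apply: tens_under].
Qed.

(* The interchange law.  A composite applied to [z] is read as a string diagram
   with domain [Z]; all rules below are stated for such applied composites, which
   makes plain rewriting insensitive to the associativity of [comp]. *)
Lemma far k a b (f : hom (power a) (power b)) X Y Z (phi : hom X Y)
    (z : hom Z (strands k (strands a X))) :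
  comp (under k (under b phi)) (comp (under k (gen a b f X)) z)
  = comp (under k (gen a b f Y)) (comp (under k (under a phi)) z).
Proof. by rewrite !comp_assoc -!under_comp gen_nat. Qed.

End Strands.
Arguments under {C H} k {X Y} f.
Arguments gen {C H} a b f X.
Arguments far {C H} k a b {f X Y Z} phi z.

(** * Translation between morphisms and diagrams *)

Ltac act_leaf H :=
  first [ refine (@acts_gen _ H 2 1 _ _) | refine (@acts_gen _ H 1 2 _ _)
        | refine (@acts_gen _ H 2 2 _ _) | refine (@acts_gen _ H 1 1 _ _)
        | refine (@acts_gen _ H 0 1 _ _) | refine (@acts_gen _ H 1 0 _ _) ].

Ltac strict := rewrite ?tens_assoc ?tens_unitl; reflexivity.

Ltac act H :=
  lazymatch goal with
  | |- acts _ (idm _) _ => apply: acts_id; strict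
  | |- acts _ (strict_id _ _) _ => apply: acts_strict_id; strict
  | |- acts _ (scomp _ _) _ => apply: acts_scomp; act H
  | |- acts _ (comp _ _) _ => apply: acts_comp; act H
  | |- acts _ (idm (_ ⊗ _) ⊗₁ _) _ => apply: acts_whisk_tens; act H
  | |- acts _ (idm unit_obj ⊗₁ _) _ => apply: acts_whisk_unit; act H
  | |- acts _ (idm _ ⊗₁ _) _ => apply: acts_whisk; act H
  | |- acts _ (_ ⊗₁ idm _) _ => apply: acts_idr; [strict | act H]
  | |- acts _ (_ ⊗₁ _) _ => apply: acts_tens; [strict | act H | act H]
  | |- acts _ _ _ => act_leaf H
  end.

Lemma law (C : strict_braided_category) (H : C) (A B A' B' : C)
    (f : hom A B) (g : hom A' B') X P Q (phi psi : hom P Q)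
    k Z (z : hom Z (strands H k P)) :
  heq f g -> acts X f phi -> acts X g psi ->
  comp (under k phi) z = comp (under k psi) z.
Proof. by move=> fg fphi gpsi; rewrite (acts_eq fphi gpsi fg). Qed.

(* Turns an equation [E] between morphisms built from generators into the
   rewriting rule it gives at height [k]. *)
Ltac law H k X z E :=
  let L := fresh in let E' := fresh in
  have E' := E; rewrite /= in E';
  eassert (L : _ = _);
    [ eapply (@law _ _ _ _ _ _ _ _ X _ _ _ _ k _ z E'); act H
    | rewrite ?under_comp ?under_id -?comp_assoc ?comp_idl ?comp_idr
      -?comp_assoc in L;
      exact: L ].

Lemma eq_heq (C : category) (A B : C) (f g : hom A B) : f = g -> heq f g.
Proof. by move->. Qed.

Lemma shom_heq (C : category) (A A' B B' : C) (eA : strict_eq A A')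
  (eB : strict_eq B B') (f : hom A B) (g : hom A' B') : f ≡ g -> heq f g.
Proof. by move/hom_eq_heq. Qed.

Lemma eq_elements {C : category} {A B : C} {phi psi : hom A B} :
  (forall Z (z : hom Z A), comp phi z = comp psi z) -> phi = psi.
Proof. by move=> /(_ A (idm A)); rewrite !comp_idr. Qed.

Lemma whisk_comp {C : strict_monoidal_category} {H X Y Z : C} (g : hom Y Z)
    (f : hom X Y) :
  idm H ⊗₁ comp g f = comp (idm H ⊗₁ g) (idm H ⊗₁ f).
Proof. by rewrite -tensm_comp comp_idl. Qed.

Lemma heq_shom {C : category} {A A' B B' : C} {eA : strict_eq A A'}
  {eB : strict_eq B B'} {f : hom A B} {g : hom A' B'} : heq f g -> f ≡ g.
Proof. by move/hom_eq_heq; apply. Qed.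

(* The converse: at [X := unit_obj] an equation of diagrams gives back the
   equation between the original morphisms. *)
Ltac drawn H :=
  eapply acts_heq; [act H | act H |];
  apply: eq_elements => Z z;
  rewrite ?whisk_comp ?comp_idl ?comp_idr -?comp_assoc.

Unset Implicit Arguments.

(** * Sliding morphisms through crossings *)

Section Braid.
Context {C : strict_braided_category} {H : C}.
Implicit Types X Y Z : C.
Local Notation F X := (H ⊗ X).
Local Notation c k z := (comp (under k (gen 2 2 (braid H H) _)) z).

Lemma heq_braidr {A B B' : C} : B = B' -> heq (braid A B) (braid A B').
Proof. by move->. Qed.

Lemma heq_braidl {A A' B : C} : A = A' -> heq (braid A B) (braid A' B).
Proof. by move->. Qed.

(** An invertible idempotent is an identity. Idempotency is asked of a copy [g] of [f], since [f]
    itself is an endomorphism only up to [A = B]. *)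
Lemma heq_iso_idem {A B : C} {f : hom A B} : A = B -> is_iso f ->
  (forall g : hom A A, heq f g -> comp g g = g) -> heq f (idm A).
Proof.
move=> eAB; case: B / eAB f => f [g [gf _]] /(_ f (heq_refl f)) ff.
apply: eq_heq; by rewrite -gf -{2}ff comp_assoc gf comp_idl.
Qed.

(** The hexagon at [unit_obj ⊗ unit_obj] exhibits this braiding as its own square. *)
Lemma braid_unitr (A : C) : heq (braid A unit_obj) (idm A).
Proof.
apply: (@heq_trans _ _ _ _ _ _ _ _ (idm (A ⊗ unit_obj))); last first.
  exact/heq_idm/tens_unitr.
apply: heq_iso_idem;
  [by rewrite tens_unitl tens_unitr|exact: braid_iso|move=> g fg].
apply: heq_eq; apply: heq_sym.
apply: heq_trans (heq_sym fg) _.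
apply: (@heq_trans _ _ _ _ _ _ _ _ (braid A (unit_obj ⊗ unit_obj))).
  exact: heq_braidr (esym (tens_unitl _)).
apply: heq_trans (shom_heq (braid_hexagon_r _ _ _)) _.
apply: heq_scomp; apply: heq_trans _ fg.
  exact: (hom_eq_along_heq (tensm_unitl _)).
exact: (hom_eq_along_heq (tensm_unitr _)).
Qed.

(** In this family, [right] or [left] tells on which input strand of the crossing [f] sits, and the
    digits count its inputs and outputs. Naturality moves [f]; a hexagon splits the crossing with a
    doubled strand. *)
Lemma braid_right12 (f : hom H (H ⊗ H)) k {X Z}
    (z : hom Z (strands H k (F (F X)))) :
  c k.+1 (c k (comp (under k.+1 (gen 1 2 f _)) z))
  = comp (under k (gen 1 2 f _)) (c k z).
Proof.
have E : heq (((idm H ⊗₁ braid H H) ∘ (braid H H ⊗₁ idm H)) ∘ (idm H ⊗₁ f))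
    (comp (f ⊗₁ idm H) (braid H H)).
  rewrite -braid_nat; apply: heq_scomp (heq_refl _).
  exact: heq_sym (shom_heq (braid_hexagon_r _ _ _)).
law H k X z E.
Qed.

Lemma braid_left12 (f : hom H (H ⊗ H)) k {X Z}
    (z : hom Z (strands H k (F (F X)))) :
  c k (c k.+1 (comp (under k (gen 1 2 f _)) z))
  = comp (under k.+1 (gen 1 2 f _)) (c k z).
Proof.
have E : heq (((braid H H ⊗₁ idm H) ∘ (idm H ⊗₁ braid H H)) ∘ (f ⊗₁ idm H))
    (comp (idm H ⊗₁ f) (braid H H)).
  rewrite -braid_nat; apply: heq_scomp (heq_refl _).
  exact: heq_sym (shom_heq (braid_hexagon_l _ _ _)).
law H k X z E.
Qed.

Lemma braid_right21 (f : hom (H ⊗ H) H) k {X Z}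
    (z : hom Z (strands H k (F (F (F X))))) :
  c k (comp (under k.+1 (gen 2 1 f _)) z)
  = comp (under k (gen 2 1 f _)) (c k.+1 (c k z)).
Proof.
have E : heq (comp (braid H H) (idm H ⊗₁ f))
    ((f ⊗₁ idm H) ∘ ((idm H ⊗₁ braid H H) ∘ (braid H H ⊗₁ idm H))).
  rewrite braid_nat; apply: heq_sym; apply: heq_scomp (heq_refl _) _.
  exact: heq_sym (shom_heq (braid_hexagon_r _ _ _)).
law H k X z E.
Qed.

Lemma braid_left11 (f : hom H H) k {X Z}
    (z : hom Z (strands H k (F (F X)))) :
  c k (comp (under k (gen 1 1 f _)) z)
  = comp (under k.+1 (gen 1 1 f _)) (c k z).
Proof. law H k X z (eq_heq (braid_nat f (idm H))). Qed.

Lemma braid_right01 (f : hom unit_obj H) k {X Z}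
    (z : hom Z (strands H k (F X))) :
  c k (comp (under k.+1 (gen 0 1 f _)) z) = comp (under k (gen 0 1 f _)) z.
Proof.
have E : heq (comp (braid H H) (idm H ⊗₁ f)) ((f ⊗₁ idm H) ∘ (idm H)).
  rewrite braid_nat; apply: heq_sym; apply: heq_scomp (heq_refl _) _.
  exact: heq_sym (braid_unitr H).
law H k X z E.
Qed.

Lemma braid_unitl (A : C) : heq (braid unit_obj A) (idm A).
Proof.
apply: (@heq_trans _ _ _ _ _ _ _ _ (idm (unit_obj ⊗ A))); last first.
  exact/heq_idm/tens_unitl.
apply: heq_iso_idem;
  [by rewrite tens_unitl tens_unitr|exact: braid_iso|move=> g fg].
apply: heq_eq; apply: heq_sym.
apply: heq_trans (heq_sym fg) _.
apply: (@heq_trans _ _ _ _ _ _ _ _ (braid (unit_obj ⊗ unit_obj) A)).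
  exact: heq_braidl (esym (tens_unitl _)).
apply: heq_trans (shom_heq (braid_hexagon_l _ _ _)) _.
apply: heq_scomp; apply: heq_trans _ fg.
  exact: (hom_eq_along_heq (tensm_unitr _)).
exact: (hom_eq_along_heq (tensm_unitl _)).
Qed.

Lemma braid_right10 (f : hom H unit_obj) k {X Z}
    (z : hom Z (strands H k (F (F X)))) :
  comp (under k (gen 1 0 f _)) (c k z) = comp (under k.+1 (gen 1 0 f _)) z.
Proof.
have E : heq (comp (f ⊗₁ idm H) (braid H H)) (idm H ∘ (idm H ⊗₁ f)).
  rewrite -braid_nat; apply: heq_sym.
  exact: heq_scomp (heq_sym (braid_unitr H)) (heq_refl _).
law H k X z E.
Qed.

Lemma braid_left10 (f : hom H unit_obj) k {X Z}
    (z : hom Z (strands H k (F (F X)))) :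
  comp (under k.+1 (gen 1 0 f _)) (c k z) = comp (under k (gen 1 0 f _)) z.
Proof.
have E : heq (comp (idm H ⊗₁ f) (braid H H)) (idm H ∘ (f ⊗₁ idm H)).
  rewrite -braid_nat; apply: heq_sym.
  exact: heq_scomp (heq_sym (braid_unitl H)) (heq_refl _).
law H k X z E.
Qed.

End Braid.

Section StrandCalculus.
Context {C : strict_braided_category} {D : coalgebra_data C} {S : hopf_data D}.
Implicit Types X Y Z : C.
Local Notation H := (carrier D).

Notation m k z := (comp (under k (gen 2 1 (hprod S) _)) z).
Notation d k z := (comp (under k (gen 1 2 (coprod D) _)) z).
Notation u k z := (comp (under k (gen 0 1 (hunit S) _)) z).
Notation e k z := (comp (under k (gen 1 0 (counit D) _)) z).
Notation s k z := (comp (under k (gen 1 1 (antipode S) _)) z).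
Notation c k z := (comp (under k (gen 2 2 (braid H H) _)) z).
Local Notation F X := (H ⊗ X).

(** * Hopf algebra laws and antimultiplicativity of the antipode *)

Section HopfLaws.
Variable hS : is_hopf S.

Lemma mulA k {X Z} (z : hom Z (strands H k (F (F (F X))))) :
  m k (m k z) = m k (m k.+1 z).
Proof.
law (carrier D) k X z (shom_heq (alg_assoc (bialg_alg (hopf_bialg hS)))).
Qed.

Lemma mul_unitl k {X Z} (z : hom Z (strands H k (F X))) : m k (u k z) = z.
Proof.
law (carrier D) k X z (shom_heq (alg_unitl (bialg_alg (hopf_bialg hS)))).
Qed.

Lemma mul_unitr k {X Z} (z : hom Z (strands H k (F X))) : m k (u k.+1 z) = z.
Proof.
law (carrier D) k X z (shom_heq (alg_unitr (bialg_alg (hopf_bialg hS)))).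
Qed.

Lemma coprodA k {X Z} (z : hom Z (strands H k (F X))) :
  d k (d k z) = d k.+1 (d k z).
Proof.
law (carrier D) k X z (shom_heq (coalg_coassoc (bialg_coalg (hopf_bialg hS)))).
Qed.

Lemma coprod_counitl k {X Z} (z : hom Z (strands H k (F X))) : e k (d k z) = z.
Proof.
law (carrier D) k X z (shom_heq (coalg_counitl (bialg_coalg (hopf_bialg hS)))).
Qed.

Lemma coprod_counitr k {X Z} (z : hom Z (strands H k (F X))) :
  e k.+1 (d k z) = z.
Proof.
law (carrier D) k X z (shom_heq (coalg_counitr (bialg_coalg (hopf_bialg hS)))).
Qed.

Lemma coprod_mul k {X Z} (z : hom Z (strands H k (F (F X)))) :
  d k (m k z) = m k (m k.+2 (c k.+1 (d k (d k.+1 z)))).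
Proof.
law (carrier D) k X z (eq_heq (coalg_mor_coprod (bialg_prod (hopf_bialg hS)))).
Qed.

Lemma counit_mul k {X Z} (z : hom Z (strands H k (F (F X)))) :
  e k (m k z) = e k (e k.+1 z).
Proof.
law (carrier D) k X z (eq_heq (coalg_mor_counit (bialg_prod (hopf_bialg hS)))).
Qed.

Lemma coprod_unit k {X Z} (z : hom Z (strands H k X)) :
  d k (u k z) = u k (u k z).
Proof.
law (carrier D) k X z (eq_heq (coalg_mor_coprod (bialg_unit (hopf_bialg hS)))).
Qed.

Lemma counit_unit k {X Z} (z : hom Z (strands H k X)) : e k (u k z) = z.
Proof.
law (carrier D) k X z (eq_heq (coalg_mor_counit (bialg_unit (hopf_bialg hS)))).
Qed.

Lemma antipode_convr k {X Z} (z : hom Z (strands H k (F X))) :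
  m k (s k.+1 (d k z)) = u k (e k z).
Proof. law (carrier D) k X z (eq_heq (hopf_antipoder hS)). Qed.

Lemma antipode_convl k {X Z} (z : hom Z (strands H k (F X))) :
  m k (s k (d k z)) = u k (e k z).
Proof. law (carrier D) k X z (eq_heq (hopf_antipodel hS)). Qed.

(** Since [1] is grouplike, [λ(1) 1] is the convolution of [λ] and [id] at [1]. *)
Lemma antipode_unit k {X Z} (z : hom Z (strands H k X)) : s k (u k z) = u k z.
Proof.
by rewrite -[LHS](mul_unitr k) (far k 1 1) (far k 0 1) -(coprod_unit k)
  (antipode_convl k) (counit_unit k).
Qed.

(* The coproduct of [H ⊗ H]. *)
Local Notation dd k z := (c k.+1 (d k (d k.+1 z))).

(** Sliding coproducts through the crossings reduces this to coassociativity in each factor. *)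
Lemma coprod2A k {X Z} (z : hom Z (strands H k (F (F X)))) :
  dd k (dd k z) = dd k.+2 (dd k z).
Proof.
rewrite -(braid_right12 _ k.+1) -!(far k 1 2) (coprodA k).
rewrite (far k.+1 2 2) -(braid_left12 _ k.+1) (far k.+1 2 2).
by rewrite !(far k.+1 1 2) !(far k 1 2) (coprodA k.+1).
Qed.

Lemma coprod2_counitl k {X Z} (z : hom Z (strands H k (F (F X)))) :
  e k (e k.+1 (dd k z)) = z.
Proof.
by rewrite braid_right10 (far k 1 2) (coprod_counitl k) (coprod_counitl k.+1).
Qed.

Lemma coprod2_counitr k {X Z} (z : hom Z (strands H k (F (F X)))) :
  e k.+2 (e k.+3 (dd k z)) = z.
Proof.
by rewrite (far k.+1 2 2) braid_left10 (far k 1 2) (coprod_counitr k.+1)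
  (coprod_counitr k).
Qed.

Local Notation sm k z := (s k (m k z)).
Local Notation ss k z := (m k (c k (s k (s k.+1 z)))).

Lemma antipode_mul_convl k {X Z} (z : hom Z (strands H k (F (F X)))) :
  m k (sm k (m k.+2 (dd k z))) = u k (e k (e k.+1 z)).
Proof. by rewrite -(coprod_mul k) (antipode_convl k) (counit_mul k). Qed.

(** In [a1 b1 λ(b2) λ(a2)] the inner pair collapses first, then the outer one. *)
Lemma antipode_mul_convr k {X Z} (z : hom Z (strands H k (F (F X)))) :
  m k (m k (ss k.+2 (dd k z))) = u k (e k (e k.+1 z)).
Proof.
rewrite (mulA k) -(mulA k.+1).
rewrite -(far k.+2 1 1) -braid_left11 (far k.+1 2 2) -braid_right21.
rewrite (far k.+1 1 1) (far k.+1 1 1) (far k 1 2) (far k 1 2)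
  (antipode_convr k.+1).
by rewrite -(far k 1 2) -(far k.+1 1 1) braid_right01 (mul_unitl k.+1)
  (antipode_convr k).
Qed.

(* Both sides are convolution inverses of the product in Hom(H ⊗ H, H). *)
Lemma antipode_mul k {X Z} (z : hom Z (strands H k (F (F X)))) :
  s k (m k z) = m k (c k (s k (s k.+1 z))).
Proof.
(* In the triple convolution of [sm], the product and [ss], the first two factors cancel here; after
   reassociation the last two do. *)
have A : m k (m k (sm k (m k.+2 (ss k.+4 (dd k (dd k z)))))) = ss k z.
  rewrite !(far k.+1 2 2).
  rewrite !(far k 1 2) !(far k.+1 1 2) (antipode_mul_convl k) (mul_unitl k).
  by rewrite -!(far k.+1 1 0) -4!(far k 1 0) (coprod2_counitl k).
rewrite -A (coprod2A k) (mulA k) (far k 1 1) (far k 2 1)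
  (antipode_mul_convr k.+2).
by rewrite -(far k 2 1) -(far k 1 1) (mul_unitr k) (coprod2_counitr k).
Qed.

End HopfLaws.

(** * The action of a brace triple and the product of [H_BT] *)

Section BraceTriple.
Context {gamma : hom (D ⊗ D) D} {T : hom D D}.
Variable hBT : is_brace_triple S gamma T.

Local Notation hS := (bt_hopf hBT).
Notation g k z := (comp (under k (gen 2 1 gamma _)) z).
Notation t k z := (comp (under k (gen 1 1 T _)) z).

Lemma coprod_act k {X Z} (z : hom Z (strands H k (F (F X)))) :
  d k (g k z) = g k (g k.+2 (c k.+1 (d k (d k.+1 z)))).
Proof.
law (carrier D) k X z (eq_heq (coalg_mor_coprod (bt_coalg_mor hBT))).
Qed.

Lemma counit_act k {X Z} (z : hom Z (strands H k (F (F X)))) :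
  e k (g k z) = e k (e k.+1 z).
Proof.
law (carrier D) k X z (eq_heq (coalg_mor_counit (bt_coalg_mor hBT))).
Qed.

Lemma act_cocomm k {X Z} (z : hom Z (strands H k (F (F X)))) :
  g k (c k.+1 (d k z)) = g k (c k.+1 (c k (d k z))).
Proof. law (carrier D) k X z (eq_heq (bt_cocomm hBT)). Qed.

Lemma act_mul k {X Z} (z : hom Z (strands H k (F (F (F X))))) :
  g k (m k.+1 z) = m k (g k (g k.+2 (c k.+1 (d k z)))).
Proof. law (carrier D) k X z (shom_heq (bt_action_prod hBT)). Qed.

Lemma act_act k {X Z} (z : hom Z (strands H k (F (F (F X))))) :
  g k (g k.+1 z) = g k (m k (g k.+1 (d k z))).
Proof. law (carrier D) k X z (shom_heq (bt_action_comp hBT)). Qed.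

Lemma act_unitl k {X Z} (z : hom Z (strands H k (F X))) : g k (u k z) = z.
Proof. law (carrier D) k X z (shom_heq (bt_action_unit hBT)). Qed.

Lemma coprod_T k {X Z} (z : hom Z (strands H k (F X))) :
  d k (t k z) = c k (t k (t k.+1 (d k z))).
Proof. law (carrier D) k X z (eq_heq (bt_T_coprod hBT)). Qed.

Lemma counit_T k {X Z} (z : hom Z (strands H k (F X))) : e k (t k z) = e k z.
Proof. law (carrier D) k X z (eq_heq (bt_T_counit hBT)). Qed.

Lemma act_coprod_T k {X Z} (z : hom Z (strands H k (F (F X)))) :
  m k (g k.+1 (d k (t k z))) = m k (g k.+1 (t k (t k.+1 (d k z)))).
Proof. law (carrier D) k X z (eq_heq (bt_T_action hBT)). Qed.

Lemma act_T_antipode k {X Z} (z : hom Z (strands H k (F X))) :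
  g k (t k.+1 (d k z)) = s k z.
Proof. law (carrier D) k X z (eq_heq (bt_T_antipode hBT)). Qed.

(* The map a ↦ a ▷ 1 is a coalgebra morphism, hence convolution invertible,
   and it is convolution idempotent. *)
Lemma act_unitr k {X Z} (z : hom Z (strands H k (F X))) :
  g k (u k.+1 z) = u k (e k z).
Proof.
have guu j Y W (w : hom W (strands H j (F Y))) :
    g j (g j.+2 (c j.+1 (d j (u j.+1 (u j.+1 w)))))
    = g j (u j.+1 (g j.+1 (u j.+2 (d j w)))).
  rewrite -!(far j 1 2) -(far j.+2 0 1) -(far j.+1 2 2) braid_right01.
  by rewrite !(far j.+1 0 1).
have gu_idem j Y W (w : hom W (strands H j (F Y))) :
    m j (g j (u j.+1 (g j.+1 (u j.+2 (d j w))))) = g j (u j.+1 w).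
  by rewrite -guu -(act_mul j) (mul_unitl hS j.+1).
have gu_d Y W (w : hom W (strands H k (F Y))) :
    u k (e k w) = m k (s k (g k (u k.+1 (g k.+1 (u k.+2 (d k w)))))).
  by rewrite -guu -(coprod_unit hS k.+1) -(coprod_act k) (antipode_convl hS k)
    (counit_act k) (counit_unit hS k.+1).
(* Inserting [λ(a1 ▷ 1) (a2 ▷ 1)] in front of [a3 ▷ 1] lets idempotency merge the last two
   factors. *)
rewrite [RHS]gu_d -[z in LHS](coprod_counitl hS k) -[LHS](mul_unitl hS k)
  -2!(far k 0 1).
rewrite gu_d 2!(far k 2 1) (mulA hS k) (coprodA hS k).
rewrite !(far k 1 1) !(far k 2 1) 3!(far k.+1 0 1) 2!(far k.+1 2 1)
  2!(far k.+2 0 1).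
by rewrite gu_idem.
Qed.

Local Notation b k z := (m k (g k.+1 (d k z))).

(** Comultiplying [a1 (a2 ▷ x)] gives [a1 (a3 ▷ x1) ⊗ a2 (a4 ▷ x2)]; [act_cocomm] exchanges the
    copies [a2] and [a3], one of which acts. *)
Lemma coprod_mulBT k {X Z} (z : hom Z (strands H k (F (F X)))) :
  d k (b k z) = b k (b k.+2 (c k.+1 (d k (d k.+1 z)))).
Proof.
rewrite (coprod_mul hS k) (coprod_act k.+1) -!(far k 1 2) braid_right21
  (coprodA hS k).
rewrite (far k.+1 1 2) -(coprodA hS k.+1) 2!(far k.+1 1 2) -(act_cocomm k.+1).
rewrite -(braid_left12 _ k.+2) -(coprodA hS k.+1) (far k.+2 2 2).
by rewrite !(far k.+1 1 2) (far k.+1 2 1).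
Qed.

Lemma counit_mulBT k {X Z} (z : hom Z (strands H k (F (F X)))) :
  e k (b k z) = e k (e k.+1 z).
Proof.
by rewrite (counit_mul hS k) (counit_act k.+1) (far k 1 2)
  (coprod_counitr hS k).
Qed.

Lemma mulBT_unitl k {X Z} (z : hom Z (strands H k (F X))) : b k (u k z) = z.
Proof.
by rewrite (coprod_unit hS k) (far k 0 1) (mul_unitl hS k) (act_unitl k).
Qed.

Lemma mulBT_unitr k {X Z} (z : hom Z (strands H k (F X))) : b k (u k.+1 z) = z.
Proof.
by rewrite -(far k 1 2) (act_unitr k.+1) (mul_unitr hS k) (coprod_counitr hS k).
Qed.

(** Both sides reduce to [a1 ((a2 ▷ x1) (a3 ▷ (x2 ▷ y)))], the left one by [act_act] and the right
    one by [act_mul]. *)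
Lemma mulBTA k {X Z} (z : hom Z (strands H k (F (F (F X))))) :
  b k (b k z) = b k (b k.+1 z).
Proof.
rewrite (coprod_mulBT k) (far k 2 1) (mulA hS k) -!(far k 1 2) -!(far k.+1 2 1)
  -(act_act k.+2).
rewrite (coprodA hS k) !(far k.+1 2 1) (act_mul k.+1).
by rewrite -(far k.+1 1 2) -(far k.+2 2 2) (far k.+1 1 2).
Qed.

Lemma T_convr k {X Z} (z : hom Z (strands H k (F X))) :
  b k (t k.+1 (d k z)) = u k (e k z).
Proof.
by rewrite -(far k 1 2) (coprodA hS k) (act_T_antipode k.+1)
  (antipode_convr hS k).
Qed.

Lemma Gamma_mulBT k {X Z} (z : hom Z (strands H k (F (F X)))) :
  m k (s k (b k.+1 (d k z))) = g k z.
Proof.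
rewrite -(far k 1 1) -(mulA hS k) -(far k 1 1) -(coprodA hS k) -(far k 2 1).
by rewrite (antipode_convl hS k) (coprod_counitl hS k) (far k 0 1)
  (mul_unitl hS k).
Qed.

(** This becomes the brace compatibility once [Gamma] is [gamma]: both sides are
    [a1 (a2 ▷ x) (a3 ▷ y)]. *)
Lemma mulBT_mul k {X Z} (z : hom Z (strands H k (F (F (F X))))) :
  b k (m k.+1 z) = m k (b k (g k.+2 (c k.+1 (d k z)))).
Proof.
rewrite -(far k 1 2) (act_mul k.+1) (mulA hS k).
by rewrite -!(far k 1 2) (coprodA hS k).
Qed.

(* By the rule for a ↦ T(a) ▷ -, the left side is T(a1) λ⁻¹(T(a2)); applying λ
   turns it into (id * λ)(T(a)). *)
Lemma T_convl k {X Z} (z : hom Z (strands H k (F X))) :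
  b k (t k (d k z)) = u k (e k z).
Proof.
have [r rs tr] := bt_T_antipode_inv hBT.
have rsE j Y W (w : hom W (strands H j (F Y))) :
  comp (under j (gen 1 1 r _)) (s j w) = w.
  law (carrier D) j Y w (eq_heq (proj1 rs)).
have srE j Y W (w : hom W (strands H j (F Y))) :
  s j (comp (under j (gen 1 1 r _)) w) = w.
  law (carrier D) j Y w (eq_heq (proj2 rs)).
have trE j Y W (w : hom W (strands H j (F Y))) :
  g j (t j (d j w)) = comp (under j (gen 1 1 r _)) (t j w).
  law (carrier D) j Y w (eq_heq tr).
rewrite (act_coprod_T k) (coprodA hS k) -2!(far k 1 1) trE -[LHS]rsE
  (antipode_mul hS k) srE.
(* The crossing produced by antimultiplicativity is exactly the one that [coprod_T] absorbs. *)
rewrite (far k 1 1) braid_left11 -coprod_T (antipode_convr hS k) (counit_T k).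
(* As [λ] fixes [1], so does its inverse [r]. *)
by rewrite -[in LHS](antipode_unit hS k) rsE.
Qed.

(** * From diagrams back to the Hopf algebra and brace axioms *)

Lemma Gamma_H_BT : Gamma S (H_BT S gamma T) = gamma.
Proof.
apply: heq_eq; rewrite /Gamma /H_BT /mu_BT /=.
by drawn (carrier D); apply: (Gamma_mulBT 0).
Qed.

Lemma H_BT_hopf : is_hopf (H_BT S gamma T).
Proof.
rewrite /H_BT /mu_BT; split => /=; [split | |].
- split.
  + apply: heq_shom; by drawn (carrier D); apply: (mulBT_unitl 0).
  + apply: heq_shom; by drawn (carrier D); apply: (mulBT_unitr 0).
  + apply: heq_shom; by drawn (carrier D); apply: (mulBTA 0).
- exact: bialg_coalg (hopf_bialg hS).
- exact: bialg_unit (hopf_bialg hS).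
- split; apply: heq_eq => /=.
  + by drawn (carrier D); apply: (counit_mulBT 0).
  + by drawn (carrier D); apply: (coprod_mulBT 0).
- apply: heq_eq; by drawn (carrier D); apply: (T_convr 0).
- apply: heq_eq; by drawn (carrier D); apply: (T_convl 0).
Qed.

Lemma H_BT_brace : is_hopf_brace S (H_BT S gamma T).
Proof.
split; [exact: hS | exact: H_BT_hopf |].
rewrite Gamma_H_BT; apply: heq_shom; rewrite /H_BT /mu_BT /=.
by drawn (carrier D); apply: (mulBT_mul 0).
Qed.

End BraceTriple.

End StrandCalculus.

Theorem theorem2p10 (C : strict_braided_category) (D : coalgebra_data C)
    (H : hopf_data D) (gamma : hom (tens D D) D) (T : hom D D)
    (hBT : is_brace_triple H gamma T) :
  is_hopf (H_BT H gamma T) /\ is_s_hopf_brace H (H_BT H gamma T).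
Proof.
split; first exact: H_BT_hopf hBT.
split; rewrite ?(Gamma_H_BT hBT).
- exact: H_BT_brace hBT.
- exact: bt_cocomm hBT.
- exact: bt_antipode_iso hBT.
- exact: bt_T_iso hBT.
- exact: bt_T_action hBT.
- exact: bt_T_antipode_inv hBT.
Qed.
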